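(* Let $f,g\in L^2(\Omega)$, and let $g_N=\sum_{k=1}^N(g,\varphi_k)\varphi_k$, $f_N=\sum_{k=1}^N(f,\varphi_k)\varphi_k$ be spectral truncations satisfying $$\|g-g_N\|\le\zeta_1,\qquad\|f-f_N\|\le\zeta_2,$$ with $\zeta_1,\zeta_2>0$. Let $g_{N,\tau,r}^\delta$ be the finite-dimensional exponential-type Tikhonov regularized solution, and assume that the regularization parameter $\tau>0$ is chosen by the Morozov discrepancy principle $\|Kg_{N,\tau,r}^\delta-\hat h_N^\delta\|=\rho\delta$, where $\rho>1$. Then, for any fixed $N$ and any $p>0$, $$\|g_{N,\tau,r}^{\delta}-g\|\le C M_N^{\frac{2}{p+2}}\left[(1+\rho)^{\frac{p}{p+2}}\delta^{\frac{p}{p+2}}+\zeta_2^{\frac{p}{p+2}}+\zeta_1^{\frac{p}{p+2}}\right]+\zeta_1,$$ where $M_N>0$ is a bound for $\|g_{N,\tau,r}^\delta-g_N\|_{D((-L)^{p/2})}$, i.e. $\|g_{N,\tau,r}^\delta-g_N\|_{D((-L)^{p/2})}\le M_N$, and $C>0$ is independent of $\delta,\rho,\zeta_1$ and $\zeta_2$.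
   Context: Fix $\alpha\in(0,1]$, $\beta\ge 0$, $l>0$, $r\in\mathbb{R}$, and a bounded connected domain $\Omega\subset\mathbb{R}^d$ ($d\ge1$) with smooth boundary. $(\cdot,\cdot)$ and $\|\cdot\|$ are the inner product and norm of $L^2(\Omega)$. $-L:H^2(\Omega)\cap H_0^1(\Omega)\to L^2(\Omega)$ is a fixed symmetric uniformly elliptic operator with eigenpairs $-L\varphi_k=\lambda_k\varphi_k$, $0<\lambda_1\le\lambda_2\le\cdots\to\infty$, where $\{\varphi_k\}_{k\ge1}$ is a complete orthonormal basis of $L^2(\Omega)$. $\|\psi\|_{D((-L)^s)}=(\sum_k\lambda_k^{2s}|(\psi,\varphi_k)|^2)^{1/2}$. Kilbas–Saigo function: $E_{\alpha,m,n}(z)=1+\sum_{k=1}^\infty\prod_{j=0}^{k-1}\frac{\Gamma(\alpha(jm+n)+1)}{\Gamma(\alpha(jm+n+1)+1)}z^k$ ($\alpha,m>0$, $n>-1/\alpha$). Put $\eta_2=\frac{\Gamma(1+\beta)}{\Gamma(1+\alpha+\beta)}$, $f_k=(f,\varphi_k)$, $e_k=E_{\alpha,1+\frac{\beta}{\alpha},\frac{\beta}{\alpha}}(-\sqrt{\lambda_k}\,l^{\alpha+\beta})$ and $$\sigma_k=\frac{\eta_2}{\sqrt{\lambda_k}}\,l^{\alpha+\beta}E_{\alpha,1+\frac{\beta}{\alpha},1+\frac{2\beta}{\alpha}}\left(-\sqrt{\lambda_k}\,l^{\alpha+\beta}\right),\qquad Kv=\sum_{k=1}^\infty\sigma_k(v,\varphi_k)\varphi_k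 .$$ The exact trace at $x=l$ is $h=\sum_{k=1}^\infty f_ke_k\varphi_k-Kg$ (i.e. $h=u(l,\cdot)$ for the underlying fractional elliptic boundary value problem with boundary datum $f$ and source $g$). The noisy trace $h^\delta\in L^2(\Omega)$ satisfies $\|h^\delta-h\|\le\delta$, $\delta>0$. The noisy finite-dimensional data are $$\hat h_N^\delta=\sum_{k=1}^Nf_ke_k\varphi_k-h^\delta,\qquad \hat h_{N,k}^\delta=f_ke_k-(h^\delta,\varphi_k)\quad(1\le k\le N),$$ and for $\tau>0$ $$g_{N,\tau,r}^\delta=\sum_{k=1}^N\frac{\sigma_k}{\sigma_k^2+\tau\exp(\lambda_k^r)}\,\hat h_{N,k}^\delta\,\varphi_k .$$ *)

(* Defs.v *)
From HB Require Import structures.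
From mathcomp Require Import all_boot all_order all_algebra.
From mathcomp Require Import ring lra.
From mathcomp Require Import all_classical all_reals all_analysis.

Set Implicit Arguments.
Unset Strict Implicit.
Unset Printing Implicit Defensive.

Import Order.TTheory GRing.Theory Num.Theory.
Import numFieldNormedType.Exports.

Local Open Scope classical_set_scope.
Local Open Scope ring_scope.

(* R^n is 'rV[R]_n, with the sigma-algebra generated by the coordinates (it
   contains the open sets, open_measurable_rV); lebesgue_rV is the n-fold product
   of the one-dimensional Lebesgue measure, see lebesgue_rV_box. *)
Definition rV_coord (R : realType) (n : nat) (i : 'I_n) (v : 'rV[R]_n)
  : measurableTypeR R := v ord0 i.

HB.instance Definition _ (R : realType) (n : nat) :=
  @isMeasurable.Build (measure_tuple_display default_measure_display)
    'rV[R]_n (g_sigma_preimage (@rV_coord R n))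
    (@sigma_algebra0 _ _ _) (@sigma_algebraC _ _) (@sigma_algebra_bigcup _ _ _).

Definition rV_cons (R : realType) (n : nat) (p : 'rV[R]_n * measurableTypeR R)
  : 'rV[R]_n.+1 :=
  \row_i (if unlift ord0 i is Some j then p.1 ord0 j else p.2).

Lemma measurable_rV_coord (R : realType) (n : nat) (i : 'I_n) :
  measurable_fun [set: 'rV[R]_n] (@rV_coord R n i).
Proof.
move=> _ Y mY; rewrite setTI; apply: sub_sigma_algebra => /=.
rewrite -bigcup_seq/=; exists i => /=; first by rewrite mem_index_enum.
by exists Y => //; rewrite setTI.
Qed.

Lemma measurable_rV_cons (R : realType) (n : nat) :
  measurable_fun setT (@rV_cons R n).
Proof.
have co (i : 'I_n.+1) : measurable_fun setT (@rV_coord R n.+1 i \o @rV_cons R n).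
  rewrite /rV_cons/rV_coord /comp /=.
  under eq_fun do rewrite mxE.
  case: (unlift ord0 i) => [j|]; last exact: measurable_snd.
  exact: (measurableT_comp (@measurable_rV_coord R n j) measurable_fst).
suff sub : g_sigma_preimage (@rV_coord R n.+1)
    `<=` [set A | measurable (@rV_cons R n @^-1` A)].
  by move=> _ A mA; rewrite setTI; exact: sub.
apply: smallest_sub.
  split => /=.
  - by rewrite preimage_set0.
  - by move=> A mA; rewrite setTD preimage_setC; exact: measurableC.
  - by move=> F mF; rewrite preimage_bigcup; exact: bigcup_measurable.
move=> A; rewrite -bigcup_seq/= => -[i _ [B mB <-]] /=.
by rewrite setTI -comp_preimage -[X in measurable X]setTI; exact: co.
Qed.


Fixpoint lebesgue_rV (R : realType) (n : nat) :
    {measure set 'rV[R]_n -> \bar R} :=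
  match n with
  | 0 => \d_(0 : 'rV[R]_0)
  | n'.+1 => measure_function_pushforward__canonical__measure_function_Measure
      (lebesgue_rV R n' \x @lebesgue_measure R)%E (@measurable_rV_cons R n')
  end.

Lemma measurable_rV_box (R : realType) (n : nat)
    (B : 'I_n -> set (measurableTypeR R)) :
  (forall i, measurable (B i)) ->
  measurable [set v : 'rV[R]_n | forall i, B i (v ord0 i)].
Proof.
move=> mB.
rewrite (_ : [set _ | _] = \big[setI/setT]_(i < n) (@rV_coord R n i @^-1` B i)).
  apply: bigsetI_measurable => i _; rewrite -[X in measurable X]setTI.
  exact: measurable_rV_coord.
rewrite -bigcap_seq; apply/seteqP; split=> v /=; first by move=> h i _; exact: h.
by move=> h i; apply: h => /=; exact: mem_index_enum.
Qed.

Lemma lebesgue_rV_box (R : realType) (n : nat)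
    (B : 'I_n -> set (measurableTypeR R)) :
  (forall i, measurable (B i)) ->
  lebesgue_rV R n [set v | forall i, B i (v ord0 i)]
  = (\prod_(i < n) lebesgue_measure (B i))%E.
Proof.
elim: n B => [|n IH] B mB.
  by rewrite big_ord0 /= diracE mem_set// => -[].
rewrite big_ord_recl /= /pushforward.
rewrite (_ : _ @^-1` _ =
  [set v : 'rV[R]_n | forall i, B (lift ord0 i) (v ord0 i)] `*` B ord0).
  rewrite [LHS]product_measure1E 1?muleC//.
    by congr (_ * _)%E; exact: (IH (fun i => B (lift ord0 i))).
  exact: (measurable_rV_box (fun i => mB (lift ord0 i))).
apply/seteqP; split=> -[v x] /=; rewrite /rV_cons.
  move=> h; split=> [i|]; first by have := h (lift ord0 i); rewrite mxE liftK.
  by have := h ord0; rewrite mxE unlift_none.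
by move=> [h1 h2] i; rewrite mxE; case: unliftP => [j ->|->].
Qed.

Lemma open_measurable_rV (R : realType) (n : nat) (U : set 'rV[R]_n) :
  open U -> measurable U.
Proof.
move=> oU.
pose bx (q : 'rV[rat]_n) (k : nat) : set 'rV[R]_n :=
  [set v | forall i,
     `](ratr (q ord0 i) - k.+1%:R^-1),
       (ratr (q ord0 i) + k.+1%:R^-1)[%classic (v ord0 i)].
rewrite (_ : U = \bigcup_(p : 'rV[rat]_n * nat)
    (if `[< bx p.1 p.2 `<=` U >] then bx p.1 p.2 else set0)).
  apply: countable_bigcupT_measurable; first exact: countableP.
  move=> [q k] /=; case: ifPn => // _.
  exact: (measurable_rV_box (fun i => measurable_itv _)).
apply/seteqP; split => [v Uv|v [[q k] _] /=]; last first.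
  by case: ifPn => // /asboolP; exact.
have /nbhs_ballP[e e0 eU] : nbhs v U by exact: open_nbhs_nbhs.
have [k ke] : exists k : nat, k.+1%:R^-1 + k.+1%:R^-1 < e.
  have e20 : 0 < e / 2 by rewrite divr_gt0.
  have [k _ hk] := near_infty_natSinv_lt (PosNum e20).
  have hk' : k.+1%:R^-1 < e / 2 := hk k (leqnn _).
    by exists k; rewrite [ltRHS]splitr ltrD.
have kq i : exists q : rat, `|ratr q - v ord0 i| < k.+1%:R^-1.
  have lt : v ord0 i - k.+1%:R^-1 < v ord0 i + k.+1%:R^-1.
    by rewrite ltrD2l gtrN// invr_gt0.
  have [q] := rat_in_itvoo lt.
  rewrite in_itv/= => /andP[h1 h2]; exists q.
  by rewrite ltr_distl h1 h2.
have [q hq] := boolp.choice kq.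
exists (\row_i q i, k) => //=; rewrite ifT; last first.
  apply/asboolP => w hw; apply: eU; split=> [//|i j]; rewrite (ord1 i) /ball/=.
  have := hw j; rewrite /= in_itv/= mxE => /andP[].
  move: (hq j); rewrite ltr_distl => /andP[].
  move: ke; move: (ratr (q j)) (k.+1%:R^-1) (v ord0 j) (w ord0 j).
  move=> a b c f ke h3 h4 h1 h2.
  have {}h1 : a - b < f := h1.
  have {}h2 : f < a + b := h2.
  by rewrite ltr_distl; apply/andP; split; lra.
move=> i /=; rewrite in_itv/= mxE; have := hq i; rewrite distrC ltr_distl.
by move=> /andP[-> ->].
Qed.

Definition gamma_fun (R : realType) (x : R) : R :=
  \int[@lebesgue_measure R]_(t in `]0, +oo[) (t `^ (x - 1) * expR (- t)).

Definition kilbas_saigo (R : realType) (alpha m n z : R) : R :=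
  1 + limn (fun K : nat => \sum_(1 <= k < K)
        (\prod_(j < k) (gamma_fun (alpha * (j%:R * m + n) + 1)
                        / gamma_fun (alpha * (j%:R * m + n + 1) + 1))) * z ^+ k).

Section domain.
Context (R : realType) (d : nat).
Local Notation E := 'rV[R]_d.
Local Notation mu := (lebesgue_rV R d).
Implicit Types (U Omega : set E) (u v w : E -> R) (i j : 'I_d).

Definition partial i u : E -> R := 'D_(delta_mx ord0 i) u.

Definition iter_partial (s : seq 'I_d) u : E -> R := foldr partial u s.

Definition smooth_on U u : Prop :=
  forall (s : seq 'I_d) (x : E), U x ->
    {for x, continuous (iter_partial s u)} /\
    (forall i, derivable (iter_partial s u) x (delta_mx ord0 i)).

(* The boundary is smooth: near each of its points the open set Omega is the
   sublevel set {rho < 0} of a C^oo function with nonvanishing gradient. *)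
Definition smooth_boundary Omega : Prop :=
  forall x, closure Omega x -> ~ Omega x ->
    exists (U : set E) (rho : E -> R),
      [/\ open U, U x, smooth_on U rho,
          (forall y, U y -> (Omega y <-> rho y < 0)) &
          (forall y, U y -> exists i, partial i rho y != 0)].

Definition smooth_bounded_domain Omega : Prop :=
  [/\ open Omega, connected Omega, Omega !=set0, bounded_set Omega &
      smooth_boundary Omega].

(* Elements of L^2(Omega) are represented by functions on the whole space of
   which only the restriction to Omega matters. *)
Definition L2 Omega : set (E -> R) :=
  [set u | u \_ Omega \in Lfun mu 2%:E].

Definition L2_inner Omega u v : R := \int[mu]_(x in Omega) (u x * v x).

Definition L2_norm Omega u : R := fine 'N[mu]_2%:E[EFin \o (u \_ Omega)]%E.

Definition L2_cvg Omega (u_ : nat -> E -> R) u : Prop :=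
  [/\ (forall n, L2 Omega (u_ n)), L2 Omega u &
      L2_norm Omega (fun x => u_ n x - u x) @[n --> \oo] --> (0 : R)].

Definition L2_sum Omega (u_ : nat -> E -> R) u : Prop :=
  L2_cvg Omega (fun n x => \sum_(k < n) u_ k x) u.

(* C^oo functions with compact support in Omega. *)
Definition test_function Omega v : Prop :=
  smooth_on setT v /\
  exists A : set E, [/\ compact A, A `<=` Omega & forall x, ~ A x -> v x = 0].

Definition weak_partial Omega i u w : Prop :=
  L2 Omega w /\
  forall v, test_function Omega v ->
    L2_inner Omega u (partial i v) = - L2_inner Omega w v.

Definition weak_derivatives2 Omega u
    (Du : 'I_d -> E -> R) (D2u : 'I_d -> 'I_d -> E -> R) : Prop :=
  [/\ L2 Omega u, (forall i, weak_partial Omega i u (Du i)) &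
      (forall i j, weak_partial Omega j (Du i) (D2u i j))].

Definition H2 Omega : set (E -> R) :=
  [set u | exists Du D2u, weak_derivatives2 Omega u Du D2u].

(* H^1_0 is the closure of the test functions for the H^1 norm. *)
Definition H10 Omega : set (E -> R) :=
  [set u | exists (Du : 'I_d -> E -> R) (v_ : nat -> E -> R),
     [/\ (forall i, weak_partial Omega i u (Du i)),
         (forall n, test_function Omega (v_ n)),
         L2_cvg Omega v_ u &
         (forall i, L2_cvg Omega (fun n => partial i (v_ n)) (Du i))]].

(* L u = sum_ij a_ij d_ij u + sum_i b_i d_i u + c u on H^2, with bounded
   measurable coefficients; an operator in divergence form with Lipschitz
   coefficients expands to this form. *)
Definition uniformly_elliptic Omega (L : (E -> R) -> E -> R) : Prop :=
  exists (a : 'I_d -> 'I_d -> E -> R) (b : 'I_d -> E -> R) (c : E -> R),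
  [/\ [/\ (forall i j, measurable_fun Omega (a i j)),
          (forall i, measurable_fun Omega (b i)) & measurable_fun Omega c],
      (exists B : R, forall x, Omega x ->
         [/\ (forall i j, `|a i j x| <= B), (forall i, `|b i x| <= B)
            & `|c x| <= B]),
      (exists2 theta : R, 0 < theta & forall x, Omega x -> forall xi : E,
         theta * \sum_i xi ord0 i ^+ 2
         <= \sum_i \sum_j a i j x * xi ord0 i * xi ord0 j) &
      (forall u Du D2u, H10 Omega u -> weak_derivatives2 Omega u Du D2u ->
         (L u : E -> R) = (fun x => \sum_i \sum_j a i j x * D2u i j x
                   + \sum_i b i x * Du i x + c x * u x) %[ae mu in Omega])].

Definition symmetric_elliptic_operator Omega (L : (E -> R) -> E -> R) : Prop :=
  [/\ uniformly_elliptic Omega L,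
      (forall u, H2 Omega u -> H10 Omega u -> L2 Omega (L u)) &
      (forall u v, H2 Omega u -> H10 Omega u -> H2 Omega v -> H10 Omega v ->
         L2_inner Omega (L u) v = L2_inner Omega u (L v))].

Definition orthonormal_basis Omega (phi : nat -> E -> R) : Prop :=
  [/\ (forall k, L2 Omega (phi k)),
      (forall k m, L2_inner Omega (phi k) (phi m) = (k == m)%:R) &
      (forall u, L2 Omega u ->
         L2_sum Omega (fun k x => L2_inner Omega u (phi k) * phi k x) u)].

(* Indices start at 0: lambda k and phi k are the (k+1)-st eigenpair. *)
Definition eigenpairs Omega (L : (E -> R) -> E -> R)
    (lambda : nat -> R) (phi : nat -> E -> R) : Prop :=
  [/\ (forall k, H2 Omega (phi k) /\ H10 Omega (phi k)),
      (forall k, (fun x => - L (phi k) x) = (fun x => lambda k * phi k x)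
                   %[ae mu in Omega]),
      0 < lambda 0%N, (forall k, lambda k <= lambda k.+1) &
      lambda @ \oo --> +oo].

End domain.

Section regularization.
Context (R : realType) (d : nat) (Omega : set 'rV[R]_d)
  (lambda : nat -> R) (phi : nat -> 'rV[R]_d -> R) (alpha beta l : R).
Local Notation E := 'rV[R]_d.
Implicit Types (f g v w h hdelta : E -> R).

(* Extended-real valued, +oo off the domain of (-L)^s. *)
Definition D_norm (s : R) v : \bar R :=
  ((\sum_(0 <= k <oo)
      (lambda k `^ (2 * s) * `|L2_inner Omega v (phi k)| ^+ 2)%:E) `^ 2^-1)%E.

Definition truncation (N : nat) v : E -> R :=
  fun x => \sum_(k < N) L2_inner Omega v (phi k) * phi k x.

Definition eta2 : R := gamma_fun (1 + beta) / gamma_fun (1 + alpha + beta).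

Definition e_coef (k : nat) : R :=
  kilbas_saigo alpha (1 + beta / alpha) (beta / alpha)
    (- Num.sqrt (lambda k) * l `^ (alpha + beta)).

Definition sigma_coef (k : nat) : R :=
  eta2 / Num.sqrt (lambda k) * l `^ (alpha + beta)
  * kilbas_saigo alpha (1 + beta / alpha) (1 + 2 * beta / alpha)
      (- Num.sqrt (lambda k) * l `^ (alpha + beta)).

(* w = K v *)
Definition is_K v w : Prop :=
  L2_sum Omega
    (fun k x => sigma_coef k * L2_inner Omega v (phi k) * phi k x) w.

(* h is the exact trace of the solution with boundary datum f and source g. *)
Definition exact_trace f g h : Prop :=
  exists Ef Kg : E -> R,
    [/\ L2_sum Omega (fun k x => L2_inner Omega f (phi k) * e_coef k * phi k x) Ef,
        is_K g Kg & h = (fun x => Ef x - Kg x)].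

Definition hhat (N : nat) f hdelta : E -> R :=
  fun x => \sum_(k < N) L2_inner Omega f (phi k) * e_coef k * phi k x
           - hdelta x.

Definition hhat_coef f hdelta (k : nat) : R :=
  L2_inner Omega f (phi k) * e_coef k - L2_inner Omega hdelta (phi k).

Definition g_reg (N : nat) (tau r : R) f hdelta : E -> R :=
  fun x => \sum_(k < N)
    sigma_coef k / (sigma_coef k ^+ 2 + tau * expR (lambda k `^ r))
    * hhat_coef f hdelta k * phi k x.

End regularization.

(* Main.v *)
(* For fixed N the constant may depend on the singular values sigma_k, k < N, and
   the bound is a finite-dimensional interpolation inequality: by the discrepancy
   principle the k-th coefficient b of g_reg - g_N satisfies
   sigma_k |b| <= (1 + rho) delta |phi_k|, while |b| <= lambda_k^(-p/2) M.

   What has to be proved is sigma_k != 0, that is, positivity of a Kilbas-Saigo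
   function on the negative axis.  With z_k = A k + b and
   d_k = Gamma(z_k + alpha) / Gamma(z_k), the function G(x) = sum_k a_k x^k satisfies
   DG + x G = d_0, where D is the multiplier x^k |-> d_k x^k (a Caputo derivative in
   disguise).  D obeys an extremum principle: DG(t) <= 0 if t minimizes G on [0, t]
   and G(t) <= 0; hence G cannot have a nonpositive minimum.  To see this without
   Beta integrals, d_k is the limit over n of
   n^alpha prod_(i < n) (z_k + i) / (z_k + alpha + i), whose partial fraction
   expansion is 1 - sum_i r_i / (z_k + alpha + i) with r_i >= 0, and the multipliers
   1 / (A k + p) are positive operators (they solve A x H' + p H = G). *)
Require Import Defs.
From mathcomp Require Import all_boot all_order all_algebra.
From mathcomp Require Import ring lra.
From mathcomp Require Import all_classical all_reals all_analysis.
From mathcomp Require Import measurable_realfun.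

Set Implicit Arguments.
Unset Strict Implicit.
Unset Printing Implicit Defensive.

Import Order.TTheory GRing.Theory Num.Theory.
Import numFieldNormedType.Exports.

Local Open Scope classical_set_scope.
Local Open Scope ring_scope.

(** * The Gamma function on [1, +oo[ *)

Section gamma.
Context {R : realType}.
Implicit Types (x z t b al : R).
Local Notation mu := (@lebesgue_measure R).
Local Notation D := (`[(0 : R), +oo[%classic).

(** For [b > 0], raise [s <= expR s] at [s = t / (2 * b)] to the power [b]; hence the constant
    (2b)^b. Half of the exponential decay of the Gamma integrand is left over and gives an
    integrable majorant. *)
Lemma powR_le_expR_half b : 0 <= b ->
  exists2 K : R, 0 < K & forall t, 0 <= t -> t `^ b <= K * expR (t / 2).
Proof.
rewrite le_eqVlt => /predU1P[<-|b0].
  exists 1 => // t t0; rewrite powRr0 mul1r -[leLHS]expR0 ler_expR.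
  by rewrite divr_ge0.
exists ((2 * b) `^ b); first by rewrite powR_gt0// mulr_gt0.
move=> t t0.
have -> : expR (t / 2) = expR (t / (2 * b)) `^ b.
  rewrite -expRM; congr expR; field; rewrite ?gt_eqF//.
rewrite -powRM ?expR_ge0//; last by rewrite mulr_ge0// ltW.
apply: ge0_ler_powR; rewrite ?nnegrE ?(ltW b0)//.
  by rewrite mulr_ge0 ?expR_ge0// mulr_ge0// ltW.
have := expR_ge1Dx (t / (2 * b)).
have b20 : 0 < 2 * b by rewrite mulr_gt0.
move=> h; rewrite -ler_pdivrMl// mulrC; lra.
Qed.

Lemma cvg_expR_half : expR (- (t / 2)) @[t --> +oo] --> (0 : R).
Proof.
apply: (@cvg_comp _ _ _ (fun t : R => t / 2) (fun z : R => expR (- z)) _ (pinfty_nbhs R)).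
  by apply: gt0_cvgMly => //; exact: cvg_id.
exact: cvgr_expR.
Qed.

Lemma within_continuous_powR b : 0 <= b ->
  {within D, continuous (fun t : R => t `^ b)}.
Proof.
rewrite le_eqVlt => /predU1P[<-|b0].
  rewrite (_ : (fun t : R => t `^ 0) = cst 1); last first.
    by apply/funext => t; rewrite powRr0.
  by move=> t; exact: cvg_cst.
apply/continuous_within_itvcyP; split.
  move=> t; rewrite in_itv/= andbT => t0.
  apply: differentiable_continuous; apply/derivable1_diffP.
  exact: (@ex_derive _ _ _ _ _ _ _ (is_derive1_powR b t0)).
by rewrite powR0 ?gt_eqF//; exact: powR_cvg0.
Qed.

Lemma continuous_expR_half : continuous (fun t : R => expR (- (t / 2))).
Proof.
move=> t; apply: continuous_comp; last exact: continuous_expR.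
by apply: cvgN; apply: cvgMr_tmp; exact: cvg_id.
Qed.

Lemma within_continuous_gamma_integrand b : 0 <= b ->
  {within D, continuous (fun t : R => t `^ b * expR (- t))}.
Proof.
move=> b0 t; apply: cvgM; first exact: within_continuous_powR.
apply: continuous_subspaceT => {}t.
by apply: continuous_comp; [exact: continuousN|exact: continuous_expR].
Qed.

Lemma integral_expR_half :
  (\int[mu]_(t in D) (expR (- (t / 2)))%:E = 2%:E)%E.
Proof.
rewrite (@ge0_continuous_FTC2y R _ (fun t => - 2 * expR (- (t / 2))) 0 0).
- by rewrite mul0r oppr0 expR0 mulr1 EFinN oppeK add0e.
- by move=> *; exact: expR_ge0.
- by apply: continuous_subspaceT; exact: continuous_expR_half.
- by rewrite -[X in _ --> X](mulr0 (- 2)); apply: cvgMl_tmp; exact: cvg_expR_half.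
- by move=> t _; apply: ex_derive.
- apply: cvgMl_tmp; apply: cvg_at_right_filter; exact: continuous_expR_half.
- move=> t _; rewrite derive1E derive_val.
  by rewrite /GRing.scale/=; field.
Qed.

Lemma integrable_expR_half (K : R) :
  mu.-integrable D (fun t : R => (K * expR (- (t / 2)))%:E).
Proof.
have mh : measurable_fun D (fun t : R => expR (- (t / 2))).
  apply: measurable_funTS.
  by apply: measurableT_comp => //; apply: measurableT_comp => //; exact: measurable_funM.
rewrite (_ : (fun t => _) = (fun t => K%:E * (expR (- (t / 2)))%:E)%E)//.
apply: integrableZl => //; apply/integrableP; split.
  exact/measurable_EFinP.
under eq_integral do rewrite /= ger0_norm ?expR_ge0//.
by rewrite integral_expR_half ltry.
Qed.

Lemma gamma_integrand_le b : 0 <= b -> exists2 K : R, 0 < K &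
  forall t, 0 <= t -> t `^ b * expR (- t) <= K * expR (- (t / 2)).
Proof.
move=> b0; have [K K0 hK] := powR_le_expR_half b0; exists K => // t t0.
have -> : expR (- (t / 2)) = expR (t / 2) * expR (- t).
  by rewrite -expRD; congr expR; field.
by rewrite mulrA ler_wpM2r ?expR_ge0// hK.
Qed.

Lemma integrable_gamma_integrand b : 0 <= b ->
  mu.-integrable D (fun t : R => (t `^ b * expR (- t))%:E).
Proof.
move=> b0; have [K K0 hK] := gamma_integrand_le b0.
apply: (le_integrable _ _ _ (integrable_expR_half K)) => //.
  apply/measurable_EFinP; apply: measurable_funM.
    by apply: measurable_funTS; exact: measurable_powR.
  apply: measurable_funTS; apply: measurableT_comp => //.
move=> t /=; rewrite in_itv/= andbT => t0.
rewrite lee_fin !ger0_norm ?mulr_ge0 ?expR_ge0 ?powR_ge0 ?(ltW K0)//.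
exact: hK.
Qed.

(** The endpoint 0 is a null set. For [1 <= x] the integrand is continuous there (0^0 is 1 for
    [powR]), so the closed half-line suits the fundamental theorem of calculus. *)
Lemma gamma_funE x : 1 <= x ->
  gamma_fun x = \int[mu]_(t in D) (t `^ (x - 1) * expR (- t)).
Proof.
move=> x1; rewrite /gamma_fun Rintegral_itv_obnd_cbnd//.
have x10 : 0 <= x - 1 by rewrite subr_ge0.
apply: (integrableS _ _ _ (integrable_gamma_integrand x10)) => //.
by apply: subset_itvr; rewrite bnd_simp.
Qed.

Lemma gamma_fun_gt0 x : 1 <= x -> 0 < gamma_fun x.
Proof.
move=> x1; have x10 : 0 <= x - 1 by rewrite subr_ge0.
have ix := integrable_gamma_integrand x10.
rewrite gamma_funE//; apply: fine_gt0; apply/andP; split; last first.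
  have /integrableP[_] := ix; apply: le_lt_trans.
  under [leRHS]eq_integral do
    rewrite /= ger0_norm ?mulr_ge0 ?powR_ge0 ?expR_ge0//.
  exact: lexx.
(* On [1, 2] the integrand is at least [expR (- 2)], since [0 <= x - 1]. *)
apply: (@lt_le_trans _ _ (\int[mu]_(t in `[1%R, 2%R]) (expR (- 2)%R)%:E)%E).
  rewrite integral_cst//= lebesgue_measure_itv/= lte_fin ltr1n -EFinB -EFinM.
  by rewrite lte_fin mulr_gt0 ?expR_gt0// subr_gt0 ltr1n.
have sub : `[(1 : R), (2 : R)]%classic `<=` D.
  by move=> t; rewrite /= !in_itv/= andbT => /andP[+ _]; exact: le_trans.
have ix2 : mu.-integrable `[(1 : R), (2 : R)]%classic
    (fun t : R => (t `^ (x - 1) * expR (- t))%:E).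
  apply: (integrableS _ _ _ ix) => //; exact: sub.
apply: (@le_trans _ _ (\int[mu]_(t in `[1%R, 2%R]) (t `^ (x - 1) * expR (- t))%R%:E)%E).
  apply: ge0_le_integral => //.
  - exact: measurable_int ix2. 
  - move=> t /=; rewrite in_itv/= => /andP[t1 t2].
    rewrite lee_fin -[leLHS]mul1r ler_pM ?expR_ge0//.
      rewrite -[leLHS](powRr0 t); exact: ler_powR.
    by rewrite ler_expR lerN2.
apply: ge0_subset_integral => //.
  exact: measurable_int ix.
by move=> t _; rewrite lee_fin mulr_ge0 ?powR_ge0 ?expR_ge0.
Qed.

(** Integration by parts: t^x e^(-t) vanishes at 0 and at infinity, and its derivative is x t^(x-1)
    e^(-t) - t^x e^(-t). *)
Lemma gamma_funS x : 1 <= x -> gamma_fun (x + 1) = x * gamma_fun x.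
Proof.
move=> x1; have x0 : 0 < x by exact: lt_le_trans x1.
have x10 : 0 <= x - 1 by rewrite subr_ge0.
have [K K0 hK] := gamma_integrand_le (ltW x0).
have i1 := integrable_gamma_integrand x10.
have i2 := integrable_gamma_integrand (ltW x0).
have i3 := integrable_expR_half K.
have iB : mu.-integrable D (fun t : R => (x * (t `^ (x - 1) * expR (- t)))%:E).
  exact: (@integrableZl _ _ _ _ _ _ x _ i1).
have cE : {within D, continuous (fun t : R => K * expR (- (t / 2)))}.
  apply: continuous_subspaceT => t; apply: cvgMl_tmp.
  exact: continuous_expR_half.
rewrite !gamma_funE//; last by lra.
rewrite addrK.
(* [K * expR (- (t / 2))] makes the integrand nonnegative, as the fundamental
   theorem of calculus on an unbounded interval requires. *)
have : \int[mu]_(t in D) (x * (t `^ (x - 1) * expR (- t))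
    + (K * expR (- (t / 2)) - t `^ x * expR (- t))) = 2 * K.
  rewrite (@Rintegral_ge0_continuous_FTC2y R _
    (fun t => t `^ x * expR (- t) + - 2 * K * expR (- (t / 2))) 0 0).
  - rewrite powR0 ?gt_eqF// !mul0r oppr0 expR0; ring.
  - move=> t t0; rewrite addr_ge0//.
      by rewrite !mulr_ge0 ?powR_ge0 ?expR_ge0// ltW.
    by rewrite subr_ge0 hK.
  - move=> t; apply: cvgD; last apply: cvgB.
    + by apply: cvgMl_tmp; exact: within_continuous_gamma_integrand.
    + exact: cE.
    + exact: within_continuous_gamma_integrand (ltW x0) _.
  - rewrite -[X in _ --> X](addr0 0); apply: cvgD; last first.
      rewrite -[X in _ --> X](mulr0 (- 2 * K)); apply: cvgMl_tmp.
      exact: cvg_expR_half.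
    apply: (@squeeze_cvgr _ _ _ _ (cst 0) (fun t => K * expR (- (t / 2)))).
    + near=> t; rewrite mulr_ge0 ?powR_ge0 ?expR_ge0//=.
      by apply: hK; near: t; exact: nbhs_pinfty_ge.
    + exact: cvg_cst.
    + rewrite -[X in _ --> X](mulr0 K); apply: cvgMl_tmp.
      exact: cvg_expR_half.
  - move=> t t0; have := is_derive1_powR x t0 => ?.
    by apply: ex_derive.
  - apply: cvgD; last first.
      by apply: cvgMl_tmp; apply: cvg_at_right_filter; exact: continuous_expR_half.
    by have /continuous_within_itvcyP[_] :=
      within_continuous_gamma_integrand (ltW x0).
  - move=> t; rewrite in_itv/= andbT => t0; have := is_derive1_powR x t0 => ?.
    rewrite derive1E derive_val /GRing.scale/=.
    by field.
rewrite RintegralD//; last exact: (integrableB _ i3 i2).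
have i4 : mu.-integrable D (fun t : R => (expR (- (t / 2)))%:E).
  have := integrable_expR_half 1.
  by congr (mu.-integrable D _); apply/funext => t; rewrite mul1r.
rewrite RintegralB// !RintegralZl//.
rewrite [X in K * X](_ : _ = 2); last by rewrite /Rintegral integral_expR_half.
by move=> h; lra.
Unshelve. all: end_near. Qed.

(** * Bounds on quotients of Gamma values *)

Lemma powR_le_bernoulli al t : 0 < al -> al <= 1 -> 0 <= t ->
  t `^ al <= 1 + al * (t - 1).
Proof.
rewrite le_eqVlt => al0 /predU1P[->|al1] t0.
  by rewrite powRr1//; lra.
(* Young's inequality for the factors t^al and 1, with conjugate exponents 1/al and 1/(1 - al);
   hence the separate case [al = 1]. *)
have := @conjugate_powR R (t `^ al) 1 al^-1 (1 - al)^-1 (powR_ge0 _ _) ler01.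
rewrite !invrK -powRrM mulfV ?gt_eqF// powRr1// powR1 mulr1 => /(_ _ _ _)/le_trans; apply.
- by rewrite invr_gt0.
- by rewrite invr_gt0 subr_gt0.
- by ring.
- by lra.
Qed.

(* Bernoulli's inequality for [t / x], integrated against [t `^ (x - 1) * expR (- t)]. *)
Lemma gamma_funD_le x al : 1 <= x -> 0 < al -> al <= 1 ->
  gamma_fun (x + al) <= x `^ al * gamma_fun x.
Proof.
move=> x1 al0 al1; have x0 : 0 < x by exact: lt_le_trans x1.
have x10 : 0 <= x - 1 by rewrite subr_ge0.
have xa0 : 0 <= x + al - 1 by rewrite addrAC addr_ge0// ltW.
have i1 := integrable_gamma_integrand x10.
have i2 := integrable_gamma_integrand (ltW x0).
have Z c b : 0 <= b ->
    mu.-integrable D (fun t : R => (c * (t `^ b * expR (- t)))%:E).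
  move=> b0.
  exact: (@integrableZl _ _ _ _ _ _ c _ (integrable_gamma_integrand b0)).
(* The weights are the coefficients of the Bernoulli bound 1 - al + al (t/x), so that the comparison
   becomes pointwise under one integral. *)
have -> : x `^ al * gamma_fun x = x `^ al * (1 - al) * gamma_fun x
    + x `^ al * (al / x) * gamma_fun (x + 1).
  by rewrite gamma_funS//; field; rewrite gt_eqF.
rewrite !gamma_funE; [|lra..].
rewrite addrK -!RintegralZl// -RintegralD//; [|exact: Z..|exact: Z (ltW x0)].
apply: le_Rintegral => //.
- exact: integrable_gamma_integrand.
- exact: (integrableD _ (Z _ _ x10) (Z _ _ (ltW x0))).
move=> t; rewrite /= in_itv/= andbT => t0.
rewrite !mulrA -mulrDl ler_wpM2r ?expR_ge0//.
have [->|tn0] := eqVneq t 0.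
  rewrite powR0; last by rewrite gt_eqF// addrAC ltr_wpDl.
  by rewrite addr_ge0 ?mulr_ge0 ?powR_ge0 ?invr_ge0 ?subr_ge0 ?(ltW x0) ?(ltW al0).
have tp : 0 < t by rewrite lt0r tn0.
have := powR_le_bernoulli al0 al1 (divr_ge0 t0 (ltW x0)) => h.
have -> : x + al - 1 = al + (x - 1) by ring.
have -> : x `^ al * (1 - al) * t `^ (x - 1) + x `^ al * al / x * t `^ x =
   x `^ al * (1 + al * (t / x - 1)) * t `^ (x - 1).
  have -> : t `^ x = t * t `^ (x - 1).
    by rewrite -{2}(powRr1 t0) -powRD ?tn0 ?implybT// addrC subrK.
  by ring.
rewrite powRD ?tn0 ?implybT// ler_wpM2r ?powR_ge0//.
rewrite -[in leLHS](divfK (lt0r_neq0 x0) t) powRM ?(ltW x0) ?divr_ge0 ?(ltW x0)//.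
by rewrite mulrC ler_wpM2l ?powR_ge0.
Qed.

(** Since x Gamma(x) = Gamma(x + 1), this is [gamma_funD_le] at [x + al] with increment [1 - al];
    the zero increment [al = 1] is treated apart. *)
Lemma gamma_ratio_le x al : 1 <= x -> 0 < al -> al <= 1 ->
  gamma_fun x / gamma_fun (x + al) <= (x + al) `^ (1 - al) / x.
Proof.
move=> x1 al0 al1; have x0 : 0 < x by exact: lt_le_trans x1.
have xa1 : 1 <= x + al by lra.
rewrite ler_pdivrMr ?gamma_fun_gt0// mulrAC ler_pdivlMr// mulrC -gamma_funS//.
move: al1; rewrite le_eqVlt => /predU1P[->|al1].
  by rewrite subrr powRr0 mul1r.
have -> : x + 1 = x + al + (1 - al) by ring.
by apply: gamma_funD_le => //; lra.
Qed.

Lemma gamma_ratio_ge x al : 1 <= x -> 0 < al -> al <= 1 ->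
  (x `^ al)^-1 <= gamma_fun x / gamma_fun (x + al).
Proof.
move=> x1 al0 al1; have x0 : 0 < x by exact: lt_le_trans x1.
have xa1 : 1 <= x + al by lra.
rewrite ler_pdivlMr ?gamma_fun_gt0// ler_pdivrMl ?powR_gt0//.
exact: gamma_funD_le.
Qed.

Lemma gamma_funD_natE x n : 1 <= x ->
  gamma_fun (x + n%:R) = gamma_fun x * \prod_(i < n) (x + i%:R).
Proof.
move=> x1; elim: n => [|n ih]; first by rewrite big_ord0 mulr1 addr0.
rewrite big_ord_recr/= -natr1 addrA gamma_funS; last by rewrite ler_wpDr.
by rewrite ih mulrC mulrA.
Qed.

End gamma.

(** * Entire power series *)

Section entire.
Context {R : realType}.
Implicit Types (a u : R^nat) (x t g : R).

Definition entire a := forall x, cvgn (pseries a x).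

Definition psum a x : R := limn (pseries a x).

Lemma entire_norm a x : entire a -> cvgn (pseries (fun k => `|a k|) x).
Proof.
move=> ea; apply: (is_cvg_pseries_inside_norm (ea (`|x| + 1))).
by rewrite [ltRHS]ger0_norm ?ltrDl// addr_ge0.
Qed.

(** The factor [r ^+ k] only rescales the argument to r|x|, which is harmless for an entire series.
    With [r = 2] it absorbs multipliers of linear growth, as k < 2^k. *)
Lemma entire_le a u (B r : R) : 0 <= r ->
  (forall k, `|u k| <= B * r ^+ k * `|a k|) -> entire a -> entire u.
Proof.
move=> r0 ua ea x; apply: normed_cvg.
have uv k : `|u k * x ^+ k| <= (B *: (fun k => `|a k| * (r * `|x|) ^+ k)) k.
  rewrite -[leRHS]/(B * (`|a k| * (r * `|x|) ^+ k)) normrM normrX exprMn.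
  rewrite [leRHS](_ : _ = B * r ^+ k * `|a k| * `|x| ^+ k); last by ring.
  by rewrite ler_wpM2r ?exprn_ge0.
apply: (series_le_cvg _ _ uv) => //.
  by move=> k; exact: (le_trans _ (uv k)).
by apply: is_cvg_seriesZ; exact: (@entire_norm _ _ ea).
Qed.

Lemma entireD a u : entire a -> entire u -> entire (a + u).
Proof.
move=> ea eu x; rewrite (_ : pseries _ _ = pseries a x + pseries u x).
  by apply: is_cvgD; [exact: ea|exact: eu].
rewrite /pseries -seriesD; congr series.
by apply/funext => i /=; rewrite !fctE mulrDl.
Qed.

Lemma is_cvg_seriesS u : cvgn (series u) -> cvgn (series (fun k => u k.+1)).
Proof.
move=> cu; rewrite (_ : series _ = (fun n => series u n.+1 - u 0%N)).
  apply: is_cvgB; last exact: is_cvg_cst.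
  by move/cvg_ex : cu => [l cl]; apply/cvg_ex; exists l; rewrite cvg_shiftS.
by apply/funext => n; rewrite !seriesEnat/= big_nat_recl//= addrC addKr.
Qed.

Lemma entireS a : entire a -> entire (fun k => a k.+1).
Proof.
move=> ea x; apply: normed_cvg.
apply: (@series_le_cvg _ _ (fun k => `|a k.+1| * (`|x| + 1) ^+ k.+1)).
- by move=> k /=.
- by move=> k; rewrite mulr_ge0// exprn_ge0// addr_ge0.
- move=> k /=; rewrite normrM normrX ler_wpM2l//.
  apply: (@le_trans _ _ ((`|x| + 1) ^+ k)).
    by rewrite lerXn2r ?nnegrE ?lerDl// addr_ge0.
  by rewrite exprS ler_peMl ?exprn_ge0 ?addr_ge0// lerDr.
exact: (@is_cvg_seriesS (fun k => `|a k| * (`|x| + 1) ^+ k) (@entire_norm a _ ea)).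
Qed.

Lemma entire_diffs a : entire a -> entire (pseries_diffs a).
Proof.
move=> /entireS; apply: (@entire_le _ _ 2 2) => // k.
rewrite /pseries_diffs normrM ger0_norm// ler_wpM2r//.
by rewrite -exprS -natrX ler_nat ltnW// ltn_expl.
Qed.

Lemma is_derive_psum a x : entire a ->
  is_derive x 1 (psum a) (psum (pseries_diffs a) x).
Proof.
move=> ea; apply: (@pseries_snd_diffs _ a (`|x| + 1)) => //.
- exact: entire_diffs.
- by do 2 apply: entire_diffs.
by rewrite [ltRHS]ger0_norm ?ltrDl// addr_ge0.
Qed.

Lemma cvg_psum a x : entire a -> pseries a x @ \oo --> psum a x.
Proof. by move=> ea; exact: ea. Qed.

Lemma continuous_psum a : entire a -> continuous (psum a).
Proof.
move=> ea x; apply: differentiable_continuous; apply/derivable1_diffP.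
have := is_derive_psum x ea => ?; exact: ex_derive.
Qed.

Lemma psumD a u x : entire a -> entire u -> psum (a + u) x = psum a x + psum u x.
Proof.
move=> ea eu; rewrite /psum -lim_seriesD; [|exact: ea|exact: eu].
by congr (limn (series _)); apply/funext => i /=; rewrite !fctE mulrDl.
Qed.

Lemma entireZ a (c : R) : entire a -> entire (c *: a).
Proof.
apply: (@entire_le _ _ `|c| 1) => // k.
by rewrite expr1n mulr1 -normrM.
Qed.

Lemma psumZ a (c : R) x : entire a -> psum (c *: a) x = c * psum a x.
Proof.
move=> ea; rewrite /psum -[RHS]/(c *: _) -lim_seriesZ; last exact: ea.
by congr (limn (series _)); apply/funext => i /=; rewrite !fctE /GRing.scale/= mulrA.
Qed.

Lemma psum_le_norm a u x (B : R) : entire a -> entire u -> 0 <= x ->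
  (forall k, `|u k| <= B * `|a k|) -> psum u x <= B * psum (fun k => `|a k|) x.
Proof.
move=> ea eu x0 ua.
have ena : entire (fun k => `|a k|) by move=> y; exact: (@entire_norm _ _ ea).
rewrite -(psumZ B x ena); apply: lim_series_le.
- exact: (eu x).
- exact: (@entireZ _ B ena x).
move=> k; rewrite /GRing.scale/= ler_wpM2r ?exprn_ge0//.
exact: le_trans (ler_norm _) (ua k).
Qed.

(** This is the Euler operator x d/dx; it turns division of the coefficients by A k + p into a
    differential equation. *)
Lemma psum_diffs_mulr a x : entire a ->
  x * psum (pseries_diffs a) x = psum (fun k => k%:R * a k) x.
Proof.
move=> ea; have := pseries_diffs_equiv (entire_diffs ea (x := x)).
move=> /(@cvgMl_tmp _ _ _ _ _ x) h; apply/esym/cvg_lim => //.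
apply: cvg_trans h; apply: near_eq_cvg; near=> n.
rewrite !seriesEnat/= mulr_sumr; apply: eq_bigr => -[|k] _.
  by rewrite /= !mulr0n !mul0r mulr0.
  by rewrite /= exprS; ring.
Unshelve. all: end_near. Qed.

Lemma psum0 a : psum a 0 = a 0%N.
Proof.
apply/cvg_lim => //; rewrite -(cvg_shiftS _).
rewrite (_ : (fun n => _) = cst (a 0%N)); first exact: cvg_cst.
apply/funext => n /=; rewrite /pseries seriesEnat/= big_nat_recl//= expr0 mulr1.
by rewrite big1 ?addr0// => i _; rewrite expr0n/= mulr0.
Qed.

Lemma cvg_pseriesS a x : entire (fun k => a k.+1) ->
  pseries a x @ \oo --> a 0%N + x * psum (fun k => a k.+1) x.
Proof.
move=> ea; rewrite -(cvg_shiftS _).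
rewrite (_ : (fun n => _) =
  (fun n => a 0%N + x * pseries (fun k => a k.+1) x n)).
  apply: cvgD; first exact: cvg_cst.
  by apply: cvgMl_tmp; exact: cvg_psum.
apply/funext => n /=; rewrite /pseries !seriesEnat/= big_nat_recl//= expr0 mulr1.
by congr +%R; rewrite mulr_sumr; apply: eq_bigr => i _; rewrite exprS; ring.
Qed.

Lemma entire_unshift a : entire (fun k => a k.+1) -> entire a.
Proof. by move=> ea x; apply/cvg_ex; eexists; exact: cvg_pseriesS. Qed.

Lemma psumS a x : entire (fun k => a k.+1) ->
  psum a x = a 0%N + x * psum (fun k => a k.+1) x.
Proof. by move=> ea; apply/cvg_lim => //; exact: cvg_pseriesS. Qed.

Lemma entire_ratio a (q : R^nat) : (forall k, a k.+1 = q k * a k) ->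
  q @ \oo --> 0 -> entire a.
Proof.
move=> aq q0 x; apply: normed_cvg.
have [K _ hK] : \forall k \near \oo, `|q k| * `|x| <= 2^-1.
  have : (fun k => `|q k| * `|x|) @ \oo --> 0.
    by rewrite -[X in _ --> X](mul0r `|x|); apply: cvgMr_tmp;
      rewrite -(normr0 R); exact: cvg_norm.
  by move/cvgr_le; apply; rewrite invr_gt0.
(* [C] makes the geometric bound trivial for indices up to [K]; beyond [K] each term is at most half
   of the preceding one. *)
pose C := \sum_(j < K.+1) `|a j * x ^+ j| * 2 ^+ j.
have main k : `|a k * x ^+ k| <= C * 2^-1 ^+ k.
  elim: k => [|k ih].
    rewrite !expr0 !mulr1 /C big_ord_recl/= expr0 !mulr1 lerDl sumr_ge0//.
  have [Kk|kK] := leqP K k.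
    rewrite aq !exprS.
    rewrite (_ : q k * a k * (x * x ^+ k) = (q k * x) * (a k * x ^+ k)); last by ring.
    rewrite normrM normrM mulrCA ler_pM ?mulr_ge0//.
    exact: hK.
  rewrite exprVn ler_pdivlMr ?exprn_gt0//.
  rewrite /C (bigD1 (Ordinal (kK : (k.+1 < K.+1)%N)))//= lerDl sumr_ge0//.
apply: (series_le_cvg _ _ main) => //.
  by move=> k; exact: (le_trans _ (main k)).
by apply: (@is_cvg_geometric_series R C 2^-1);
  rewrite ger0_norm ?invr_ge0// invf_lt1// ltr1n.
Qed.

(** * The multipliers 1 / (A k + p) as positive operators, and partial fractions *)

Lemma entire_resolvent a (A p : R) : entire a -> 0 < A -> 0 < p ->
  entire (fun k => a k / (A * k%:R + p)).
Proof.
move=> ea A0 p0; apply: (@entire_le _ _ p^-1 1) ea => // k.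
have hd : 0 < A * k%:R + p by rewrite ltr_wpDl// mulr_ge0// ltW.
rewrite expr1n mulr1 normrM mulrC ler_wpM2r// normfV gtr0_norm//.
by rewrite lef_pV2 ?posrE// lerDr mulr_ge0// ltW.
Qed.

(** Let G be the sum of [a] and H that of the divided coefficients. Then A x H' + p H = G, and the
    constant [g / p] solves the same equation with right-hand side [g]; an integrating factor
    compares the two solutions. *)
Lemma psum_resolvent_ge a (A p t g : R) : entire a -> 0 < A -> 0 < p -> 0 < t ->
  (forall s, 0 <= s -> s <= t -> g <= psum a s) ->
  g / p <= psum (fun k => a k / (A * k%:R + p)) t.
Proof.
move=> ea A0 p0 t0 ga; set h := fun k => _.
have hd k : 0 < A * k%:R + p by rewrite ltr_wpDl// mulr_ge0// ltW.
have eh : entire h by exact: entire_resolvent.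
have ode x : A * (x * psum (pseries_diffs h) x) + p * psum h x = psum a x.
  have ekh : entire (fun k => k%:R * h k).
    apply: (@entire_le _ _ 1 2) eh => // k.
    rewrite mul1r normrM ger0_norm// ler_wpM2r// -natrX ler_nat.
    by rewrite ltnW// ltn_expl.
  rewrite psum_diffs_mulr// -!psumZ// -psumD; [|exact: entireZ..].
  congr psum; apply/funext => k; rewrite !fctE /GRing.scale/= /h.
  by field; rewrite gt_eqF.
pose q := p / A; have q0 : 0 < q by rewrite divr_gt0.
(* The power x^q is the integrating factor: the derivative of [phi] has the sign of [psum a x - g],
   and [phi 0 = 0] because [q > 0]. *)
pose phi x := x `^ q * (psum h x - g / p).
have dphi x : 0 < x -> is_derive x 1 phi (x `^ (q - 1) / A * (psum a x - g)).
  move=> x0; have ? := is_derive1_powR q x0; have ? := is_derive_psum x eh.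
  apply: is_derive_eq; rewrite -ode /GRing.scale/= subr0 /q.
  have -> : x `^ (p / A) = x * x `^ (p / A - 1).
    rewrite -{2}(powRr1 (ltW x0)) -powRD ?(gt_eqF x0) ?implybT//.
    by congr powR; ring.
  by field; rewrite !gt_eqF.
have : phi 0 <= phi t.
  apply: (@ger0_derive1_le_cc _ phi 0 t); rewrite ?in_itv/= ?lexx ?(ltW t0)//.
  - move=> x; rewrite in_itv/= => /andP[x0 _]; have ? := dphi x x0.
    exact: ex_derive.
  - move=> x; rewrite in_itv/= => /andP[x0 xt]; have ? := dphi x x0.
    rewrite derive1E derive_val mulr_ge0 ?divr_ge0 ?powR_ge0 ?(ltW A0)//.
    by rewrite subr_ge0 ga// ltW.
  (* The power x^q need not be differentiable at 0, so only one-sided continuity is used at the left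
     end. *)
  - apply/continuous_within_itvP => //; split.
    + move=> x; rewrite in_itv/= => /andP[x0 _]; have ? := dphi x x0.
      by apply: differentiable_continuous; apply/derivable1_diffP; exact: ex_derive.
    + rewrite /phi powR0 ?gt_eqF// mul0r.
      rewrite -[X in _ --> X](mul0r (psum h 0 - g / p)).
      apply: cvgM; first exact: powR_cvg0.
      apply: cvgB; last exact: cvg_cst.
      by apply: cvg_at_right_filter; exact: continuous_psum.
    + apply: cvg_at_left_filter; have ? := dphi t t0.
      by apply: differentiable_continuous; apply/derivable1_diffP; exact: ex_derive.
rewrite /phi powR0 ?gt_eqF// mul0r pmulr_rge0 ?powR_gt0//.
by rewrite subr_ge0.
Qed.

(** Induction on [n]: with w = z + al, the new factor is 1 - al / (w + n), and 1 / ((w + i) (w + n))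
    = (1 / (w + i) - 1 / (w + n)) / (n - i). The old coefficients are multiplied by 1 - al / (n -
    i), nonnegative because al <= 1 <= n - i; the coefficient [s] of the new pole collects the
    rest. *)
Lemma prod_ratio_partial_fractions (al : R) n : 0 <= al -> al <= 1 ->
  exists2 r : R^nat, (forall i, 0 <= r i) &
    forall z, 0 < z -> \prod_(i < n) ((z + i%:R) / (z + al + i%:R)) =
      1 - \sum_(i < n) r i / (z + al + i%:R).
Proof.
move=> al0 al1; elim: n => [|n [r r0 ih]].
  by exists (fun=> 0) => // z _; rewrite !big_ord0 subr0.
have ni (i : 'I_n) : 1 <= n%:R - i%:R :> R.
  by rewrite -natrB ?ler1n ?subn_gt0// ltnW.
pose s := al * (1 + \sum_(i < n) r i / (n%:R - i%:R)).
have s0 : 0 <= s.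
  rewrite mulr_ge0// addr_ge0// sumr_ge0// => i _.
  by rewrite divr_ge0// (le_trans _ (ni i)).
exists (fun i => if (i < n)%N then r i * (1 - al / (n%:R - i%:R)) else s).
  move=> i; case: ltnP => // lin; have := ni (Ordinal lin) => /= h.
  by rewrite mulr_ge0// subr_ge0 ler_pdivrMr ?mul1r ?(le_trans al1)//
    (lt_le_trans _ h).
move=> z z0; rewrite !big_ord_recr/= ltnn ih//.
have zi i : z + al + i%:R != 0 by rewrite gt_eqF// ltr_wpDr// ltr_wpDr.
under [in RHS]eq_bigr => i _ do rewrite ltn_ord.
have -> : (z + n%:R) / (z + al + n%:R) = 1 - al / (z + al + n%:R).
  by field.
have -> : \sum_(i < n) r i * (1 - al / (n%:R - i%:R)) / (z + al + i%:R) =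
  \sum_(i < n) r i / (z + al + i%:R) * (1 - al / (z + al + n%:R))
  - al / (z + al + n%:R) * \sum_(i < n) r i / (n%:R - i%:R).
  rewrite mulr_sumr -sumrB; apply: eq_bigr => i _.
  have := ni i => h; field; rewrite !zi/= gt_eqF//.
  by rewrite (lt_le_trans _ h).
rewrite -mulr_suml /s; field; exact: zi.
Qed.

End entire.

(** * Positivity of Kilbas-Saigo functions *)

Section positivity.
Context {R : realType}.
Implicit Types (a u : R^nat) (x t g : R).

Lemma entire_sum (n : nat) (F : nat -> R^nat) : (forall i, entire (F i)) ->
  entire (\sum_(i < n) F i).
Proof.
move=> eF; elim: n => [|n ih]; last by rewrite big_ord_recr/=; exact: entireD.
rewrite big_ord0; apply: (@entire_le _ (F 0%N) _ 0 0) => // k.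
by rewrite normr0 !mul0r.
Qed.

Lemma psum_sum (n : nat) (F : nat -> R^nat) t : (forall i, entire (F i)) ->
  psum (\sum_(i < n) F i) t = \sum_(i < n) psum (F i) t.
Proof.
move=> eF; elim: n => [|n ih]; last first.
  by rewrite !big_ord_recr/= psumD ?ih//; exact: entire_sum.
rewrite !big_ord0 -[X in psum X](scale0r (F 0%N)) psumZ ?mul0r//.
Qed.

(** Extremum principle for the finite products. By partial fractions, the sum is G(t) minus
    nonnegative multiples of resolvents of G; each resolvent is bounded below by its value on the
    constant G(t), the minimum of G on [0, t]. *)
Lemma psum_prod_ratio_le0 a (A b al : R) n t : entire a ->
  0 < A -> 0 < b -> 0 <= al -> al <= 1 -> 0 < t ->
  (forall s, 0 <= s -> s <= t -> psum a t <= psum a s) -> psum a t <= 0 ->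
  psum (fun k => (\prod_(i < n) ((A * k%:R + b + i%:R) / (A * k%:R + b + al + i%:R)))
                 * a k) t <= 0.
Proof.
move=> ea A0 b0 al0 al1 t0 amin at0.
have [r r0 rE] := prod_ratio_partial_fractions n al0 al1.
pose h i : R^nat := fun k => a k / (A * k%:R + (b + al + i%:R)).
have p0 (i : nat) : 0 < b + al + i%:R by rewrite ltr_wpDr// ltr_wpDr.
have eh i : entire (r i *: h i).
  by apply: entireZ; exact: entire_resolvent.
rewrite (_ : (fun k => _) = a + (-1) *: (\sum_(i < n) r i *: h i)); last first.
  apply/funext => k; rewrite !fctE fct_sumE rE; last first.
    by rewrite ltr_wpDl// mulr_ge0// ltW.
  rewrite mulrBl mul1r scaleN1r mulr_suml; congr (_ - _).
  apply: eq_bigr => i _; rewrite !fctE /h /GRing.scale/= !addrA; ring.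
have es := @entire_sum n _ eh.
rewrite psumD//; last exact: entireZ.
rewrite psumZ// (@psum_sum n _ t eh).
(* A constant has only the coefficient of index 0, where the multiplier is the product at [z = b];
   being nonnegative, it keeps the sign of [psum a t]. *)
apply: (@le_trans _ _ (psum a t * \prod_(i < n) ((b + i%:R) / (b + al + i%:R)))).
  rewrite rE// mulrBr mulr1 mulN1r lerD2l lerN2 mulr_sumr ler_sum// => i _.
  rewrite psumZ; last exact: (@entire_resolvent _ a A).
  rewrite mulrCA ler_wpM2l//.
  by apply: (@psum_resolvent_ge _ a A).
rewrite mulr_le0_ge0// prodr_ge0// => i _.
by rewrite divr_ge0 ?addr_ge0// ltW.
Qed.

(** With y = z + n, the two quotient bounds give (n / y)^al <= n^al Gamma(y) / Gamma(y + al) <= (y +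
    al) / y. The error is linear in [z], so summed against entire coefficients it remains of order
    1/n. *)
Lemma gamma_ratio_shift_approx (al z : R) n : 0 < al -> al <= 1 -> 1 <= z ->
  (0 < n)%N ->
  `|1 - n%:R `^ al * (gamma_fun (z + n%:R) / gamma_fun (z + n%:R + al))|
    <= z / n%:R.
Proof.
move=> al0 al1 z1 n0; have z0 : 0 < z by exact: lt_le_trans z1.
have nR : 0 < n%:R :> R by rewrite ltr0n.
set y := z + n%:R; have y1 : 1 <= y by rewrite ler_wpDr.
have y0 : 0 < y by exact: lt_le_trans y1.
have ny : n%:R <= y by rewrite ler_wpDl// ltW.
have h1 := gamma_ratio_le y1 al0 al1; have h2 := gamma_ratio_ge y1 al0 al1.
set w := _ / _ in h1 h2 *.
have P0 : 0 < n%:R `^ al :> R by exact: powR_gt0.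
rewrite ler_norml; apply/andP; split.
  rewrite lerBrDr addrC lerBlDr.
  apply: (@le_trans _ _ ((y + al) `^ al * ((y + al) `^ (1 - al) / y))).
    apply: ler_pM => //; first by rewrite (le_trans _ h2)// invr_ge0 powR_ge0.
    by apply: ge0_ler_powR; rewrite ?nnegrE; lra.
  rewrite mulrA -powRD; last by rewrite gt_eqF ?implybT//; lra.
  rewrite [al + _]addrC subrK powRr1; last by lra.
  rewrite mulrDl divff ?gt_eqF// lerD2l.
  by rewrite ler_pM// ?invr_ge0 ?(ltW y0) ?(ltW al0)//; [lra|rewrite lef_pV2].
apply: (@le_trans _ _ (1 - n%:R `^ al / y `^ al)).
  by rewrite lerD2l lerN2 ler_wpM2l// ltW.
have -> : n%:R `^ al / y `^ al = (n%:R / y) `^ al.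
  rewrite powRM ?invr_ge0 ?(ltW y0)// -(powR_inv1 (ltW y0)) powRAC.
  by rewrite powR_inv1// powR_ge0.
rewrite lerBlDr -lerBlDl.
apply: (@le_trans _ _ (n%:R / y)).
  rewrite lerBlDr -lerBlDl.
  have -> : 1 - n%:R / y = z / y by rewrite /y; field; rewrite gt_eqF.
  by rewrite ler_wpM2l ?(ltW z0)// lef_pV2.
have q0 : 0 < n%:R / y by rewrite divr_gt0.
have q1 : n%:R / y <= 1 by rewrite ler_pdivrMr// mul1r.
by apply: ger1_powR; rewrite ?q0.
Qed.

(** The quotient [d k] is the limit of n^al times the finite products, with a total error of at most
    1/n times a convergent series; the sign given by [psum_prod_ratio_le0] survives the limit. *)
Lemma psum_gamma_multiplier_le0 a (A b al : R) t :
  let d k := gamma_fun (A * k%:R + b + al) / gamma_fun (A * k%:R + b) in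
  entire a -> entire (d * a) -> 0 < A -> 1 <= b -> 0 < al -> al <= 1 -> 0 < t ->
  (forall s, 0 <= s -> s <= t -> psum a t <= psum a s) -> psum a t <= 0 ->
  psum (d * a) t <= 0.
Proof.
move=> d ea eda A0 b1 al0 al1 t0 amin at0.
have b0 : 0 < b by exact: lt_le_trans b1.
pose z k := A * k%:R + b.
have z1 k : 1 <= z k by rewrite /z ler_wpDl// mulr_ge0// ltW.
have z0 k : 0 < z k by exact: lt_le_trans (z1 k).
have ezda : entire (z * (d * a)).
  apply: (@entire_le _ (d * a) _ (A + b) 2) => // k.
  rewrite normrM ler_wpM2r// (gtr0_norm (z0 k)) /z mulrDl lerD//.
    by rewrite ler_pM2l// -natrX ler_nat ltnW// ltn_expl.
  by rewrite ler_peMr ?(ltW b0)// -natrX ler1n expn_gt0.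
pose w n k := n%:R `^ al * (gamma_fun (z k + n%:R) / gamma_fun (z k + n%:R + al)).
(* The functional equation, applied [n] times to Gamma(z + n) and to Gamma(z + al + n), cancels the
   Gamma values and leaves the finite product. *)
have dw n k : d k * w n k = n%:R `^ al *
    \prod_(i < n) ((z k + i%:R) / (z k + al + i%:R)).
  rewrite prodf_div /d /w -/(z k) [z k + n%:R + al]addrAC.
  have zal : 1 <= z k + al by rewrite ler_wpDr// ltW.
  rewrite !gamma_funD_natE//.
  have pz : 0 < \prod_(i < n) (z k + al + i%:R).
    by apply: prodr_gt0 => i _; rewrite ltr_wpDr// (lt_le_trans _ zal).
  have alg (g1 g2 p1 p2 c : R) : 0 < g1 -> 0 < g2 -> 0 < p2 ->
      g2 / g1 * (c * (g1 * p1 / (g2 * p2))) = c * (p1 / p2).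
    by move=> *; field; rewrite !gt_eqF.
  by apply: alg => //; exact: gamma_fun_gt0.
(* Split [d * a] into the error [u1], of relative size z_k / n, and n^al times [u2], whose sum at
   [t] is nonpositive. *)
have key n : (0 < n)%N ->
    psum (d * a) t <= n%:R^-1 * psum (fun k => `|(z * (d * a)) k|) t.
  move=> n0; have hw k := gamma_ratio_shift_approx al0 al1 (z1 k) n0.
  pose u1 : R^nat := fun k => (1 - w n k) * (d * a) k.
  have u1le k : `|u1 k| <= n%:R^-1 * `|(z * (d * a)) k|.
    rewrite normrM [X in _ <= _ * X]normrM mulrA ler_wpM2r//.
    by rewrite (gtr0_norm (z0 k)) mulrC; exact: hw.
  have eu1 : entire u1.
    apply: (@entire_le _ _ _ n%:R^-1 1) ezda => // k.
    by rewrite expr1n mulr1.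
  pose u2 : R^nat := fun k =>
    \prod_(i < n) ((z k + i%:R) / (z k + al + i%:R)) * a k.
  have nal0 : 0 < n%:R `^ al :> R by rewrite powR_gt0// ltr0n.
  have u2E : d * a = u1 + n%:R `^ al *: u2.
    apply/funext => k; rewrite -[LHS]/(d k * a k).
    rewrite -[RHS]/((1 - w n k) * (d k * a k) + n%:R `^ al *
      (\prod_(i < n) ((z k + i%:R) / (z k + al + i%:R)) * a k)) mulrA -dw.
    by ring.
  have eu2 : entire u2.
    have -> : u2 = (n%:R `^ al)^-1 *: (d * a + (-1) *: u1).
      rewrite u2E scaleN1r addrAC subrr add0r scalerA mulVf ?scale1r//.
      by rewrite gt_eqF.
    by apply: entireZ; apply: entireD => //; exact: entireZ.
  rewrite u2E psumD//; last exact: entireZ.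
  rewrite -[leRHS]addr0 -u2E lerD//.
    by apply: psum_le_norm => //; exact: ltW.
  rewrite psumZ// pmulr_rle0//.
  by apply: psum_prod_ratio_le0 => //; exact: ltW.
(* A positive value would be at most a constant over [n] for every [n > 0], against the Archimedean
   property. *)
rewrite leNgt; apply/negP => X0.
set P := psum (fun k => `|_|) t in key.
have P0 : 0 <= P by have := key 1%N erefl; rewrite invr1 mul1r; apply: le_trans (ltW X0).
have := archi_boundP (divr_ge0 P0 (ltW X0)); set n := Num.bound _ => hn.
have n0 : (0 < n)%N by rewrite -(ltr0n R); apply: le_lt_trans hn; rewrite divr_ge0// ltW.
have := key n n0; rewrite ler_pdivlMl ?ltr0n// leNgt => /negP; apply.
by move: hn; rewrite ltr_pdivrMr.
Qed.

(** With z = A k + b, the quotient is at most (1 + al / z) / (z + al)^al, hence at most 2 / (z +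
    al)^al. This feeds the ratio test for the Kilbas-Saigo series. *)
Lemma cvg_gamma_ratio (A b al : R) : 0 < A -> 1 <= b -> 0 < al -> al <= 1 ->
  (fun k => gamma_fun (A * k%:R + b) / gamma_fun (A * k%:R + b + al)) @ \oo --> 0.
Proof.
move=> A0 b1 al0 al1; apply/cvgr0Pnorm_le => e e0.
(* [B] solves (A B)^al = 2 / e. *)
pose B := (2 / e) `^ al^-1 / A.
have B0 : 0 <= B by rewrite divr_ge0 ?powR_ge0// ltW.
exists (Num.bound B) => //= k /= Bk; set z := A * k%:R + b.
have z1 : 1 <= z by rewrite ler_wpDl// mulr_ge0// ltW.
have z0 : 0 < z by exact: lt_le_trans z1.
have zal : 1 <= z + al by rewrite ler_wpDr// ltW.
rewrite ger0_norm; last by rewrite divr_ge0// ltW// gamma_fun_gt0.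
apply: (le_trans (gamma_ratio_le z1 al0 al1)).
have za0 : 0 < z + al by exact: lt_le_trans zal.
have -> : (z + al) `^ (1 - al) / z = (1 + al / z) / (z + al) `^ al.
  rewrite powRB ?(gt_eqF za0) ?implybT// powRr1 ?ltW//.
  by field; rewrite !gt_eqF// powR_gt0.
have h : 2 / e <= (z + al) `^ al.
  have e20 : 0 <= 2 / e by rewrite divr_ge0// ltW.
  rewrite [leLHS](_ : _ = ((2 / e) `^ al^-1) `^ al); last first.
    by rewrite -powRrM mulVf ?gt_eqF// powRr1.
  apply: ge0_ler_powR; rewrite ?nnegrE ?powR_ge0 ?(ltW al0) ?(ltW za0)//.
  have : B <= k%:R.
    by apply: le_trans (ltW (archi_boundP B0)) _; rewrite ler_nat.
  by rewrite ler_pdivrMr// => h; rewrite (le_trans h)// /z; lra.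
apply: (@le_trans _ _ (2 / (2 / e))).
  apply: ler_pM; rewrite ?invr_ge0 ?powR_ge0 ?addr_ge0 ?divr_ge0 ?(ltW al0) ?(ltW z0)//.
    have : al / z <= 1 by rewrite ler_pdivrMr// mul1r (le_trans al1).
    by lra.
  by rewrite lef_pV2 ?posrE ?powR_gt0 ?divr_gt0.
by rewrite invf_div mulrCA divff ?mulr1.
Qed.

Theorem kilbas_saigo_gt0 (al m n x : R) : 0 < al -> al <= 1 -> 0 < m -> m <= n ->
  0 <= x -> 0 < kilbas_saigo al m n (- x).
Proof.
move=> al0 al1 m0 mn x0.
(* The index is shifted by one: A (j + 1) + b = al (j m + n) + 1, so the ratios in the Kilbas-Saigo
   product are [(d j.+1)^-1]. The condition [m <= n] ensures [1 <= b]. *)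
pose A := al * m; pose b := al * (n - m) + 1.
have A0 : 0 < A by exact: mulr_gt0.
have b1 : 1 <= b by rewrite lerDr mulr_ge0 ?subr_ge0// ltW.
pose d k := gamma_fun (A * k%:R + b + al) / gamma_fun (A * k%:R + b).
have d0 k : 0 < d k.
  have z1 : 1 <= A * k%:R + b by rewrite ler_wpDl// mulr_ge0// ltW.
  by rewrite divr_gt0// gamma_fun_gt0//; lra.
pose a : R^nat := fun k => (-1) ^+ k * \prod_(j < k) (d j.+1)^-1.
have a0 : a 0%N = 1 by rewrite /a big_ord0 expr0 mulr1.
have aS k : a k.+1 = - (d k.+1)^-1 * a k.
  by rewrite /a exprS big_ord_recr/=; ring.
have ea : entire a.
  apply: (entire_ratio aS); rewrite -oppr0; apply: cvgN.
  have := cvg_gamma_ratio A0 b1 al0 al1; rewrite -(cvg_shiftS _).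
  apply: cvg_trans; apply: near_eq_cvg; near=> k.
  by rewrite /d invf_div.
(* In terms of sums, DG = d_0 - x G, where D is the multiplier by [d]. *)
have daS k : (d * a) k.+1 = - a k.
  by rewrite -[LHS]/(d k.+1 * a k.+1) aS mulrA mulrN divff ?gt_eqF// mulN1r.
have daSE : (fun k => (d * a) k.+1) = (-1) *: a.
  by apply/funext => k; rewrite daS -[RHS]/(-1 * a k) mulN1r.
have edaS : entire (fun k => (d * a) k.+1) by rewrite daSE; exact: entireZ.
have -> : kilbas_saigo al m n (- x) = psum a x.
  rewrite /kilbas_saigo; set f := fun K : nat => _.
  suff h : f @ \oo --> psum a x - 1 by rewrite (cvg_lim _ h)// addrC subrK.
  have : (fun K => pseries a x K - 1) @ \oo --> psum a x - 1.
    by apply: cvgB; [exact: cvg_psum|exact: cvg_cst].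
  apply: cvg_trans; apply: near_eq_cvg; near=> K.
  (* The sum in [kilbas_saigo] starts at index 1; the term of index 0 is the summand 1 outside the
     limit, and it can be split off only from a nonempty partial sum. *)
  have K0 : (0 < K)%N by near: K; exists 1%N.
  rewrite /pseries seriesEnat/= big_ltn// a0 expr0 mulr1 addrC addKr.
  apply: eq_bigr => k _; rewrite exprNn /a mulrAC mulrC; congr (_ * _).
  apply: eq_bigr => j _; rewrite /d invf_div.
  have -> : A * j.+1%:R + b + al = al * (j%:R * m + n + 1) + 1.
    by rewrite /A /b -natr1; ring.
  have -> // : A * j.+1%:R + b = al * (j%:R * m + n) + 1.
  by rewrite /A /b -natr1; ring.
rewrite ltNge; apply/negP => ax0.
(* If G(x) <= 0, a minimum point [t] of G on [0, x] is positive because G(0) = 1, and it also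
   minimizes G on [0, t]. *)
have [t + tmin] : exists2 t, t \in `[0, x] &
    forall s, s \in `[0, x] -> psum a t <= psum a s.
  by apply: EVT_min => //; apply: continuous_subspaceT; exact: continuous_psum.
rewrite in_itv/= => /andP[t0 tx].
have at0 : psum a t <= 0.
  by apply: le_trans ax0; apply: tmin; rewrite in_itv/= x0/=.
have tp : 0 < t.
  rewrite lt0r t0 andbT; apply: contraTneq at0 => ->.
  by rewrite psum0 a0 -ltNge.
have : psum (d * a) t <= 0.
  apply: psum_gamma_multiplier_le0 => //; first exact: entire_unshift.
  by move=> s s0 st; apply: tmin; rewrite in_itv/= s0 (le_trans st).
(* Here DG(t) = d_0 - t G(t) >= d_0 > 0, contrary to the extremum principle. *)
rewrite psumS// daSE psumZ// -[(d * a) 0%N]/(d 0%N * a 0%N) a0 mulr1 mulN1r.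
have : t * psum a t <= 0 by rewrite mulr_ge0_le0.
have := d0 0%N; lra.
Unshelve. all: end_near. Qed.

End positivity.

(** * L2 inner products *)

Section L2_theory.
Context {R : realType} {d : nat} (Omega : set 'rV[R]_d).
Hypothesis mOmega : measurable Omega.
Local Notation mu := (lebesgue_rV R d).
Local Notation inner := (L2_inner Omega).
Local Notation norm := (L2_norm Omega).
Implicit Types u v w : 'rV[R]_d -> R.

Let restrictD u v : (fun x => u x + v x) \_ Omega = u \_ Omega \+ v \_ Omega.
Proof. by apply/funext => x /=; rewrite !patchE; case: ifP => // _; rewrite addr0. Qed.

Let restrictZ c u : (fun x => c * u x) \_ Omega = c *: (u \_ Omega : 'rV[R]_d -> R).
Proof.
apply/funext => x; rewrite -[RHS]/(c * (u \_ Omega) x) !patchE.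
by case: ifP => // _; rewrite mulr0.
Qed.

Let restrictM u v : (fun x => u x * v x) \_ Omega = (u \_ Omega) \* (v \_ Omega).
Proof. by apply/funext => x /=; rewrite !patchE; case: ifP => // _; rewrite mulr0. Qed.

Let p1 : (1 <= 2%:E :> \bar R)%E. Proof. by rewrite lee_fin ler1n. Qed.

Lemma L2D u v : L2 Omega u -> L2 Omega v -> L2 Omega (fun x => u x + v x).
Proof.
rewrite /L2/= restrictD => hu hv; have [_] := Lfun_addr_closed mu p1; exact.
Qed.

Lemma L2Z c u : L2 Omega u -> L2 Omega (fun x => c * u x).
Proof.
rewrite /L2/= restrictZ => hu.
have [h0 h] := Lfun_submod_closed mu p1.
by rewrite -[X in X \in _](addr0 (c *: (u \_ Omega : 'rV[R]_d -> R))); apply: h.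
Qed.

Lemma L2B u v : L2 Omega u -> L2 Omega v -> L2 Omega (fun x => u x - v x).
Proof.
move=> hu hv; have := L2D hu (L2Z (-1) hv).
by congr L2; apply/funext => x; rewrite mulN1r.
Qed.

Lemma L2_sum_ord n (F : nat -> 'rV[R]_d -> R) :
  (forall i, L2 Omega (F i)) -> L2 Omega (fun x => \sum_(i < n) F i x).
Proof.
move=> hF; elim: n => [|n ih].
  have := L2Z 0 (hF 0%N).
  by congr L2; apply/funext => x; rewrite big_ord0 mul0r.
have := L2D ih (hF n).
by congr L2; apply/funext => x; rewrite big_ord_recr.
Qed.

Lemma L2_integrableM u v : L2 Omega u -> L2 Omega v ->
  mu.-integrable Omega (EFin \o (fun x => u x * v x)).
Proof.
move=> hu hv; have /Lfun1_integrable := Lfun2_mul_Lfun1 hu hv.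
rewrite -restrictM => h; apply/(integrable_mkcond _ mOmega).
by rewrite -restrict_EFin in h *.
Qed.

Lemma L2_innerDl u v w : L2 Omega u -> L2 Omega v -> L2 Omega w ->
  inner (fun x => u x + v x) w = inner u w + inner v w.
Proof.
move=> hu hv hw; rewrite /L2_inner -RintegralD//; [|exact: L2_integrableM..].
by apply: eq_Rintegral => x _; rewrite mulrDl.
Qed.

Lemma L2_innerZl c u w : L2 Omega u -> L2 Omega w ->
  inner (fun x => c * u x) w = c * inner u w.
Proof.
move=> hu hw; rewrite /L2_inner -RintegralZl//; last exact: L2_integrableM.
by apply: eq_Rintegral => x _; rewrite mulrA.
Qed.

Lemma L2_innerBl u v w : L2 Omega u -> L2 Omega v -> L2 Omega w ->
  inner (fun x => u x - v x) w = inner u w - inner v w.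
Proof.
move=> hu hv hw; rewrite -[X in _ + X]mulN1r -L2_innerZl// -L2_innerDl//; last exact: L2Z.
by congr (L2_inner _ _ _); apply/funext => x; rewrite mulN1r.
Qed.

Lemma L2_inner_sum_ord n (F : nat -> 'rV[R]_d -> R) w :
  (forall i, L2 Omega (F i)) -> L2 Omega w ->
  inner (fun x => \sum_(i < n) F i x) w = \sum_(i < n) inner (F i) w.
Proof.
move=> hF hw; elim: n => [|n ih].
  rewrite big_ord0 -[RHS](mul0r (inner (F 0%N) w)) -L2_innerZl//.
  by congr (L2_inner _ _ _); apply/funext => x; rewrite big_ord0 mul0r.
rewrite big_ord_recr/= -ih -L2_innerDl//; last exact: L2_sum_ord.
by congr (L2_inner _ _ _); apply/funext => x; rewrite big_ord_recr.
Qed.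

(** On [L2] the extended norm is finite, so [fine] loses nothing. *)
Let L2_normE u : L2 Omega u -> (norm u)%:E = 'N[mu]_2%:E[EFin \o (u \_ Omega)]%E.
Proof. by move=> hu; exact: (@finite_norm_fine _ _ _ _ _ p1 (Lfun_Sub p1 hu)). Qed.

Lemma L2_norm_ge0 u : 0 <= norm u.
Proof. by rewrite fine_ge0// Lnorm_ge0. Qed.

Lemma L2_normD u v : L2 Omega u -> L2 Omega v ->
  norm (fun x => u x + v x) <= norm u + norm v.
Proof.
move=> hu hv; rewrite /L2_norm restrictD.
exact: (ler_LnormD (Lfun_Sub p1 hu) (Lfun_Sub p1 hv)).
Qed.

Lemma L2_normZ c u : L2 Omega u -> norm (fun x => c * u x) = `|c| * norm u.
Proof.
move=> hu; apply/EFin_inj; rewrite L2_normE; last exact: L2Z.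
by rewrite EFinM L2_normE// restrictZ; exact: (LnormZ (Lfun_Sub p1 hu) c).
Qed.

Lemma L2_normC u v : L2 Omega u -> L2 Omega v ->
  norm (fun x => u x - v x) = norm (fun x => v x - u x).
Proof.
move=> hu hv; rewrite -[RHS]mul1r -(normrN1 R) -L2_normZ; last exact: L2B.
by congr L2_norm; apply/funext => x; rewrite mulN1r opprB.
Qed.

Lemma L2_norm_sum_ord n (F : nat -> 'rV[R]_d -> R) : (forall i, L2 Omega (F i)) ->
  norm (fun x => \sum_(i < n) F i x) <= \sum_(i < n) norm (F i).
Proof.
move=> hF; elim: n => [|n ih].
  rewrite big_ord0 -[leRHS](mul0r (norm (F 0%N))) -[X in X * _](normr0 R) -L2_normZ//.
  rewrite (_ : (fun x => _) = (fun x => 0 * F 0%N x))//.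
  by apply/funext => x; rewrite big_ord0 mul0r.
rewrite big_ord_recr/=; apply: le_trans (lerD ih (lexx _)).
apply: le_trans (L2_normD (L2_sum_ord _ hF) (hF n)).
rewrite (_ : (fun x => _) = (fun x => \sum_(i < n) F i x + F n x))//.
by apply/funext => x; rewrite big_ord_recr.
Qed.

Lemma L2_cauchy_schwarz u v : L2 Omega u -> L2 Omega v ->
  `|inner u v| <= norm u * norm v.
Proof.
move=> hu hv; apply: le_trans (le_normr_Rintegral mOmega (L2_integrableM hu hv)) _.
rewrite -lee_fin EFinM !L2_normE//.
have mr w : L2 Omega w -> measurable_fun setT (w \_ Omega).
  by rewrite /L2/= inE => /andP[]; rewrite inE.
have half : 2^-1 + 2^-1 = 1 :> R by rewrite [RHS]splitr !div1r.
apply: le_trans (hoelder mu (mr _ hu) (mr _ hv) (ltr0n R 2) (ltr0n R 2) half).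
rewrite Lnorm1 /Rintegral fineK; last first.
  by apply: integrable_fin_num => //; exact: integrable_norm (L2_integrableM hu hv).
rewrite integral_mkcond le_eqVlt; apply/orP; left; apply/eqP.
apply: eq_integral => x _; rewrite -restrictM /= !patchE.
by case: ifP => // _; rewrite /= normr0.
Qed.

Lemma L2_inner_lincomb (phi : nat -> 'rV[R]_d -> R) (c : nat -> R) n k :
  orthonormal_basis Omega phi -> (k < n)%N ->
  inner (fun x => \sum_(i < n) c i * phi i x) (phi k) = c k.
Proof.
move=> [phi2 on _] kn.
have cphi2 i : L2 Omega (fun x => c i * phi i x) by exact: L2Z.
rewrite (@L2_inner_sum_ord n (fun i x => c i * phi i x))//.
rewrite (bigD1 (Ordinal kn))//= L2_innerZl// on eqxx mulr1.
rewrite big1 ?addr0// => i ik; rewrite L2_innerZl// on.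
by rewrite (negbTE (_ : i != k :> nat)) ?mulr0.
Qed.

(** Partial sums with more than [k] terms have k-th coefficient [c k], and by Cauchy-Schwarz taking
    a coefficient is continuous for the [L2] norm. *)
Lemma L2_inner_sum_coef (phi : nat -> 'rV[R]_d -> R) (c : nat -> R) u k :
  orthonormal_basis Omega phi ->
  L2_sum Omega (fun k x => c k * phi k x) u -> inner u (phi k) = c k.
Proof.
move=> onb [hS hu cvg0]; have [phi2 _ _] := onb.
have Sk n : (k < n)%N -> inner (fun x => \sum_(i < n) c i * phi i x) (phi k) = c k.
  exact: L2_inner_lincomb.
have lim0 : norm (fun x => \sum_(i < n) c i * phi i x - u x) * norm (phi k)
    @[n --> \oo] --> (0 : R).
  by rewrite -[X in _ --> X](mul0r (norm (phi k))); exact: cvgMr_tmp.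
apply/esym/eqP; rewrite -subr_eq0 -normr_le0.
apply: (cvgr_to_ge lim0); exists k.+1 => //= n /= kn.
rewrite -{1}(Sk n kn) -L2_innerBl//.
by apply: L2_cauchy_schwarz => //; apply: L2B => //; exact: hS.
Qed.

Lemma D_norm_coef_le (lambda : nat -> R) (phi : nat -> 'rV[R]_d -> R) s v M k :
  0 < lambda k -> 0 <= M -> (D_norm Omega lambda phi s v <= M%:E)%E ->
  lambda k `^ s * `|inner v (phi k)| <= M.
Proof.
move=> l0 M0; rewrite /D_norm; set S := (\sum_(0 <= _ <oo) _)%E => SM.
have : ((lambda k `^ (2 * s) * `|inner v (phi k)| ^+ 2)%:E <= S)%E.
  have := @nneseries_lim_ge R
    (fun k => (lambda k `^ (2 * s) * `|inner v (phi k)| ^+ 2)%:E) xpredT 0%N k.+1.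
  rewrite big_mkord big_ord_recr/= => h; apply: le_trans (h _); last first.
    by move=> n _ _; rewrite lee_fin mulr_ge0 ?powR_ge0.
  rewrite leeDr// sume_ge0// => i _; by rewrite lee_fin mulr_ge0 ?powR_ge0.
move: S SM => [S| |]//=.
  rewrite !lee_fin => SM tS.
  have S0 : 0 <= S by apply: le_trans tS; rewrite mulr_ge0 ?powR_ge0.
  apply: le_trans SM; rewrite powR12_sqrt//.
  rewrite -(ger0_norm (powR_ge0 (lambda k) s)) -normrM -sqrtr_sqr ler_wsqrtr//.
  rewrite (le_trans _ tS)// exprMn real_normK ?num_real//.
  by rewrite [2 * s]mulrC powRrM powR_mulrn ?powR_ge0.
(* An infinite sum has an infinite square root, the exponent being nonzero; this contradicts the
   finite bound [M]. *)
by rewrite invr_eq0 pnatr_eq0.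
Qed.

End L2_theory.

(** * The error estimate *)

Lemma eigenvalue_gt0 (R : realType) d (Omega : set 'rV[R]_d)
    (L : ('rV[R]_d -> R) -> 'rV[R]_d -> R) lambda phi k :
  eigenpairs Omega L lambda phi -> 0 < lambda k.
Proof.
move=> [_ _ l0 lS _]; elim: k => // k ih; exact: lt_le_trans (lS k).
Qed.

(** The Kilbas-Saigo factor has m = 1 + beta/alpha and n = 1 + 2 beta/alpha, so m <= n follows from
    [0 <= beta], and its argument is nonpositive. *)
Lemma sigma_coef_gt0 (R : realType) (lambda : nat -> R) (alpha beta l : R) k :
  0 < alpha -> alpha <= 1 -> 0 <= beta -> 0 < l -> 0 < lambda k ->
  0 < sigma_coef lambda alpha beta l k.
Proof.
move=> a0 a1 b0 l0 lk; rewrite /sigma_coef /eta2 mulNr.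
have ba : 0 <= beta / alpha by rewrite divr_ge0// ltW.
rewrite !mulr_gt0 ?invr_gt0 ?powR_gt0 ?sqrtr_gt0 ?gamma_fun_gt0//.
- by rewrite lerDl.
- by rewrite -addrA lerDl addr_ge0// ltW.
- apply: kilbas_saigo_gt0 => //; first by rewrite ltr_wpDr.
    by rewrite lerD2l -mulrA mulr_natl mulr2n lerDl.
  by rewrite mulr_ge0 ?powR_ge0 ?sqrtr_ge0.
Qed.

(** Split x = x^th x^(1 - th) and bound each factor separately. Applied to one mode at a time, this
    interpolates between the smoothness bound and the residual bound. *)
Lemma interpolation_le (R : realType) (x a b th : R) : 0 <= x -> x <= a -> x <= b ->
  0 <= th -> th <= 1 -> x <= a `^ th * b `^ (1 - th).
Proof.
move=> x0 xa xb th0 th1.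
have -> : x = x `^ th * x `^ (1 - th).
  have e1 : th + (1 - th) = 1 by ring.
  by rewrite -powRD e1 ?powRr1// oner_eq0.
have ? : 0 <= 1 - th by rewrite subr_ge0.
by apply: ler_pM; rewrite ?powR_ge0//; apply: ge0_ler_powR;
  rewrite ?nnegrE// (le_trans x0).
Qed.

Unset Implicit Arguments.

Theorem theorem6 (R : realType) (alpha beta l r : R)
    (halpha : 0 < alpha <= 1) (hbeta : 0 <= beta) (hl : 0 < l)
    (d : nat) (hd : (1 <= d)%N)
    (Omega : set 'rV[R]_d) (hOmega : smooth_bounded_domain Omega)
    (L : ('rV[R]_d -> R) -> 'rV[R]_d -> R)
    (hL : symmetric_elliptic_operator Omega L)
    (lambda : nat -> R) (phi : nat -> 'rV[R]_d -> R)
    (heig : eigenpairs Omega L lambda phi)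
    (hphi : orthonormal_basis Omega phi)
    (N : nat) (p : R) (hp : 0 < p) :
  exists2 C : R, 0 < C &
    forall (f g h hdelta : 'rV[R]_d -> R)
           (delta rho zeta1 zeta2 tau M : R)
           (Kgreg : 'rV[R]_d -> R),
      let gN := truncation Omega phi N g in
      let fN := truncation Omega phi N f in
      let greg := g_reg Omega lambda phi alpha beta l N tau r f hdelta in
      L2 Omega f -> L2 Omega g ->
      0 < zeta1 -> 0 < zeta2 ->
      L2_norm Omega (fun x => g x - gN x) <= zeta1 ->
      L2_norm Omega (fun x => f x - fN x) <= zeta2 ->
      exact_trace Omega lambda phi alpha beta l f g h ->
      0 < delta -> L2 Omega hdelta ->
      L2_norm Omega (fun x => hdelta x - h x) <= delta ->
      0 < tau -> 1 < rho ->
      is_K Omega lambda phi alpha beta l greg Kgreg ->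
      L2_norm Omega
        (fun x => Kgreg x
                  - hhat Omega lambda phi alpha beta l N f hdelta x)
        = rho * delta ->
      0 < M ->
      (D_norm Omega lambda phi (p / 2) (fun x => (greg x - gN x)%R) <= M%:E)%E ->
      L2_norm Omega (fun x => greg x - g x)
      <= C * M `^ (2 / (p + 2))
         * ((1 + rho) `^ (p / (p + 2)) * delta `^ (p / (p + 2))
            + zeta2 `^ (p / (p + 2)) + zeta1 `^ (p / (p + 2)))
         + zeta1.
Proof.
have mO : measurable Omega by case: hOmega => oO _ _ _ _; exact: open_measurable_rV.
have [a0 a1] := andP halpha.
have lk k : 0 < lambda k := eigenvalue_gt0 k heig.
pose s := sigma_coef lambda alpha beta l.
have s0 k : 0 < s k by exact: sigma_coef_gt0.
have [phi2 _ _] := hphi.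
pose B k := L2_norm Omega (phi k).
have B0 k : 0 <= B k by exact: L2_norm_ge0.
pose th := 2 / (p + 2).
have p20 : 0 < p + 2 by rewrite addr_gt0.
have th0 : 0 <= th by rewrite divr_ge0// ltW.
have thE : 1 - th = p / (p + 2) by rewrite /th; field; rewrite gt_eqF.
have th1 : th <= 1 by rewrite -subr_ge0 thE divr_ge0 ?ltW.
(* [c k] gathers the factors free of the data: the power of [lambda k] from the smoothness norm,
   [B k / s k] from the residual, and [B k] from the norm of the mode. *)
pose c k := (lambda k `^ (p / 2))^-1 `^ th * (B k / s k) `^ (1 - th) * B k.
have c0 k : 0 <= c k by rewrite !mulr_ge0 ?powR_ge0.
(* The summand 1 keeps the constant positive even for [N = 0]. *)
exists (1 + \sum_(k < N) c k); first by rewrite ltr_pwDl// sumr_ge0.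
move=> f g h hdelta delta rho zeta1 zeta2 tau M Kgreg gN fN greg.
move=> f2 g2 z1 z2 hg hf [Ef [Kg [hEf hKg hE]]] d0 hd2 hdl tau0 rho1 hK Kdl M0 DM.
pose gk k := L2_inner Omega g (phi k).
pose rk k := s k / (s k ^+ 2 + tau * expR (lambda k `^ r))
  * hhat_coef Omega lambda phi alpha beta l f hdelta k.
pose v x := greg x - gN x.
have cphi2 (u : nat -> R) k : L2 Omega (fun x => u k * phi k x) by exact: L2Z.
have lin2 (u : nat -> R) : L2 Omega (fun x => \sum_(k < N) u k * phi k x).
  by apply: (@L2_sum_ord _ _ _ N (fun k x => u k * phi k x)) => k; exact: cphi2.
have gN2 : L2 Omega gN := lin2 gk.
have greg2 : L2 Omega greg := lin2 rk.
have vE : v = (fun x => \sum_(k < N) (rk k - gk k) * phi k x).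
  apply/funext => x; rewrite /v /greg /g_reg /gN /truncation -sumrB.
  by apply: eq_bigr => k _; rewrite mulrBl.
have vk k : (k < N)%N -> L2_inner Omega v (phi k) = rk k - gk k.
  by move=> kN; rewrite vE (@L2_inner_lincomb _ _ _ mO phi (fun k => rk k - gk k)).
have h2 : L2 Omega h by rewrite hE; apply: L2B; [case: hEf|case: hKg].
have Kgreg2 : L2 Omega Kgreg by case: hK.
have hhat2 : L2 Omega (hhat Omega lambda phi alpha beta l N f hdelta).
  by apply: L2B => //; exact: (lin2 (fun k =>
    L2_inner Omega f (phi k) * e_coef lambda alpha beta l k)).
(* For [k < N] the coefficients coming from [f] and from [hdelta] cancel: the residual and the noise
   differ in mode [k] by exactly s_k (r_k - g_k). Their norms are [rho * delta] and at most
   [delta]. *)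
have resid k : (k < N)%N -> s k * `|rk k - gk k| <= (1 + rho) * delta * B k.
  move=> kN.
  have -> : s k * `|rk k - gk k| = `|L2_inner Omega
      (fun x => Kgreg x - hhat Omega lambda phi alpha beta l N f hdelta x) (phi k)
      - L2_inner Omega (fun x => hdelta x - h x) (phi k)|.
    rewrite -[s k in LHS]gtr0_norm// -normrM; congr `|_|.
    have [Ef2 Kg2] : L2 Omega Ef /\ L2 Omega Kg by case: hEf; case: hKg.
    have ef2 := lin2 (fun k => L2_inner Omega f (phi k) * e_coef lambda alpha beta l k).
    have hhatE : L2_inner Omega (hhat Omega lambda phi alpha beta l N f hdelta) (phi k) =
        L2_inner Omega f (phi k) * e_coef lambda alpha beta l k
        - L2_inner Omega hdelta (phi k).
      rewrite (L2_innerBl mO ef2 hd2 (phi2 k)); congr (_ - _).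
      exact: (@L2_inner_lincomb _ _ _ mO phi
        (fun k => L2_inner Omega f (phi k) * e_coef lambda alpha beta l k)).
    have hcE : L2_inner Omega h (phi k) =
        L2_inner Omega f (phi k) * e_coef lambda alpha beta l k - s k * gk k.
      rewrite hE (L2_innerBl mO Ef2 Kg2 (phi2 k)).
      have -> : L2_inner Omega Kg (phi k) = s k * gk k :=
        @L2_inner_sum_coef _ _ _ mO phi (fun k => s k * gk k) Kg k hphi hKg.
      by rewrite (L2_inner_sum_coef mO k hphi hEf).
    have KgE : L2_inner Omega Kgreg (phi k) = s k * rk k.
      transitivity (s k * L2_inner Omega greg (phi k)).
        exact: (@L2_inner_sum_coef _ _ _ mO phi
          (fun k => s k * L2_inner Omega greg (phi k)) Kgreg k hphi hK).
      congr (_ * _); exact: (@L2_inner_lincomb _ _ _ mO phi rk).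
    rewrite (L2_innerBl mO Kgreg2 hhat2 (phi2 k)) (L2_innerBl mO hd2 h2 (phi2 k)).
    by rewrite hhatE hcE KgE; ring.
  apply: le_trans (ler_normB _ _) _; rewrite addrC [(1 + rho) * _]mulrDl mul1r mulrDl.
  apply: lerD; apply: le_trans (L2_cauchy_schwarz mO _ _) _ => //; try exact: L2B.
    exact: (ler_wpM2r (B0 k) hdl).
  by rewrite -Kdl.
have rd0 : 0 <= (1 + rho) * delta by rewrite mulr_ge0 ?(ltW d0)//; lra.
have bk k : (k < N)%N -> `|rk k - gk k| * B k <=
    c k * (M `^ th * ((1 + rho) * delta) `^ (1 - th)).
  move=> kN.
  have -> : c k * (M `^ th * ((1 + rho) * delta) `^ (1 - th)) =
    (((lambda k `^ (p / 2))^-1 * M) `^ th *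
     (B k / s k * ((1 + rho) * delta)) `^ (1 - th)) * B k.
    rewrite (@powRM _ _ M) ?invr_ge0 ?powR_ge0 ?(ltW M0)//.
    rewrite (@powRM _ (B k / s k)) ?divr_ge0 ?(ltW (s0 k))//.
    by rewrite /c; ring.
  (* The first bound comes from the hypothesis on [D_norm], the second from [resid] divided by
     [s k]. *)
  rewrite ler_wpM2r//; apply: interpolation_le => //.
    rewrite ler_pdivlMl ?powR_gt0// -vk//.
    by apply: D_norm_coef_le => //; exact: ltW.
  have := resid k kN; rewrite mulrC -ler_pdivlMr// => /le_trans; apply.
  by rewrite le_eqVlt; apply/orP; left; apply/eqP; ring.
have vnorm : L2_norm Omega v <=
    (\sum_(k < N) c k) * (M `^ th * ((1 + rho) * delta) `^ (1 - th)).
  rewrite vE mulr_suml.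
  (* The triangle inequality over the [N] modes suffices, since the constant may depend on [N]. *)
  pose F k x := (rk k - gk k) * phi k x.
  apply: le_trans (@L2_norm_sum_ord _ _ _ N F (cphi2 _)) _.
  apply: ler_sum => k _; rewrite (L2_normZ _ (phi2 k)).
  exact: bk.
(* The truncation error [gN - g] accounts for the isolated [zeta1]. *)
have gE : (fun x => greg x - g x) = (fun x => v x + (gN x - g x)).
  by apply/funext => x; rewrite /v; ring.
rewrite -thE gE.
have v2 : L2 Omega v by rewrite vE; exact: (lin2 (fun k => rk k - gk k)).
apply: le_trans (L2_normD v2 (L2B gN2 g2)) _.
apply: lerD; last by rewrite L2_normC.
apply: le_trans vnorm _.
rewrite -mulrA; apply: ler_pM.
- by rewrite sumr_ge0.
- by rewrite mulr_ge0 ?powR_ge0.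
- by rewrite lerDr.
rewrite ler_wpM2l ?powR_ge0// powRM ?(ltW d0)//; last by lra.
by rewrite -addrA lerDl addr_ge0 ?powR_ge0.
Qed.
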